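(* Fix $m,n\in\mathbb{N}$ with $m\ge2$, $m>n$, and $L_n>1$. There exists a centered random vector $b_0\in\mathbb{R}^n$ with $\mathbb{E}\,b_0b_0^\top=I_n$ (the same second moment as $\mathcal N(0,I_n)$) such that the following holds: with $B_0\in\mathbb{R}^{m\times n}$ denoting a random matrix whose rows are i.i.d. copies of $b_0$, and $B\equiv B_0/\sqrt m$, $$n^{-1}\mathbb{E}\lVert\hat\mu_B^{\mathsf{LSE}}-\mu_0\rVert^2\ge L_n\cdot n^{-1}\mathbb{E}\lVert\hat\mu_G^{\mathsf{LSE}}-\mu_0\rVert^2.$$
   Context: For a design $A\in\mathbb{R}^{m\times n}$, consider the linear model $Y=A\mu_0+\xi$ with $\mu_0\in\mathbb{R}^n$ and $\xi\sim\mathcal N(0,I_m)$ independent of $A$, and the ordinary least squares estimator $\hat\mu_A^{\mathsf{LSE}}\equiv\arg\min_{\mu\in\mathbb{R}^n}\lVert Y-A\mu\rVert^2=(A^\top A)^{-1}A^\top Y$. $G\in\mathbb{R}^{m\times n}$ is the standard Gaussian design with i.i.d. $\mathcal N(0,1/m)$ entries. $\lVert\cdot\rVert$ is the Euclidean norm. *)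

(* Defs.v *)
From HB Require Import structures.
From mathcomp Require Import all_boot all_order all_algebra.
From mathcomp Require Import all_classical all_reals all_analysis.

Set Implicit Arguments.
Unset Strict Implicit.
Unset Printing Implicit Defensive.
Import Order.TTheory GRing.Theory Num.Theory.
Import numFieldNormedType.Exports.
Local Open Scope classical_set_scope.
Local Open Scope ring_scope.

(* Random vectors and random matrices take their values in n.-tuple R and
   m.-tuple (n.-tuple R), which the library equips with the product (Borel)
   sigma-algebra; colv and mx view them as elements of the matrix types. *)
Definition colv (R : realType) (n : nat) (x : n.-tuple R) : 'cV[R]_n :=
  \col_i tnth x i.

Definition mx (R : realType) (m n : nat) (A : m.-tuple (n.-tuple R)) :
    'M[R]_(m, n) :=
  \matrix_(i, j) tnth (tnth A i) j.

(* The library norm `| v | on matrices is the sup norm. *)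
Definition l2norm (R : realType) (n : nat) (v : 'cV[R]_n) : R :=
  Num.sqrt (\sum_i v i 0 ^+ 2).

Section ProbabilityNotions.
Context d (T : measurableType d) (R : realType) (P : probability T R).

(* Only measurable sets are compared: normal_prob is also a (meaningless)
   function of nonmeasurable sets. *)
Definition has_law d' (T' : measurableType d') (X : T -> T')
    (nu : set T' -> \bar R) : Prop :=
  forall U, measurable U -> P (X @^-1` U) = nu U.

(* Taking U i := setT for some of the i gives the product rule for every
   subfamily. *)
Definition mutually_independent (I : finType) d' (T' : measurableType d')
    (X : I -> T -> T') : Prop :=
  forall U : I -> set T', (forall i, measurable (U i)) ->
    P (\bigcap_i (X i @^-1` U i)) = (\prod_(i : I) P (X i @^-1` U i))%E.

Definition independent d1 d2 (T1 : measurableType d1) (T2 : measurableType d2)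
    (X : T -> T1) (Y : T -> T2) : Prop :=
  forall U V, measurable U -> measurable V ->
    P (X @^-1` U `&` Y @^-1` V) = (P (X @^-1` U) * P (Y @^-1` V))%E.

Definition iid (I : finType) d' (T' : measurableType d') (X : I -> T -> T')
    (nu : set T' -> \bar R) : Prop :=
  (forall i, has_law (X i) nu) /\ mutually_independent X.

Definition standard_gaussian_vector (m : nat) (xi : T -> m.-tuple R) : Prop :=
  iid (fun i w => tnth (xi w) i) (normal_prob 0 1).

(* The second argument of normal_prob is the standard deviation. *)
Definition gaussian_design (m n : nat) (G : T -> m.-tuple (n.-tuple R)) :
    Prop :=
  iid (fun (ij : 'I_m * 'I_n) w => tnth (tnth (G w) ij.1) ij.2)
    (normal_prob 0 (Num.sqrt (m%:R^-1))).

Definition centered (n : nat) (b : T -> n.-tuple R) : Prop :=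
  forall j, ('E_P[fun w => tnth (b w) j] = 0)%E.

Definition has_second_moment (n : nat) (b : T -> n.-tuple R) (S : 'M[R]_n) :
    Prop :=
  forall i j,
    ('E_P[fun w => ((colv (b w) *m (colv (b w))^T) i j)%R] = (S i j)%:E)%E.

End ProbabilityNotions.

Definition is_least_squares (R : realType) (m n : nat) (A : 'M[R]_(m, n))
    (y : 'cV[R]_m) (mu : 'cV[R]_n) : Prop :=
  forall mu', l2norm (y - A *m mu) ^+ 2 <= l2norm (y - A *m mu') ^+ 2.

(* Meaningful only when A^T A is invertible, since invmx is the identity on
   singular matrices. *)
Definition lse (R : realType) (m n : nat) (A : 'M[R]_(m, n)) (y : 'cV[R]_m) :
    'cV[R]_n :=
  invmx (A^T *m A) *m A^T *m y.

Lemma l2norm_sqr (R : realType) (n : nat) (v : 'cV[R]_n) :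
  l2norm v ^+ 2 = \sum_i v i 0 ^+ 2.
Proof. by rewrite sqr_sqrtr // sumr_ge0 // => i _; rewrite sqr_ge0. Qed.

Lemma l2norm_sqrE (R : realType) (n : nat) (v : 'cV[R]_n) :
  l2norm v ^+ 2 = (v^T *m v) 0 0.
Proof.
by rewrite l2norm_sqr mxE; apply: eq_bigr => i _; rewrite mxE expr2.
Qed.

Lemma least_squaresP (R : realType) (m n : nat) (A : 'M[R]_(m, n))
    (y : 'cV[R]_m) (mu : 'cV[R]_n) :
  A^T *m A \in unitmx -> is_least_squares A y mu <-> mu = lse A y.
Proof.
move=> uA.
pose r := y - A *m lse A y.
have ATr : A^T *m r = 0.
  by rewrite /r mulmxBr /lse !mulmxA mulmxV // mul1mx subrr.
have rTA : r^T *m A = 0 by rewrite -[A]trmxK -trmx_mul ATr trmx0.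
have E nu : l2norm (y - A *m nu) ^+ 2
    = l2norm r ^+ 2 + l2norm (A *m (lse A y - nu)) ^+ 2.
  have -> : y - A *m nu = r + A *m (lse A y - nu).
    by rewrite mulmxBr /r addrA subrK.
  move: (lse A y - nu) (r) ATr rTA => z {}r ATr rTA.
  rewrite !l2norm_sqrE [(_ + _)^T]linearD /= mulmxDl !mulmxDr.
  rewrite [r^T *m (A *m _)]mulmxA rTA mul0mx.
  have -> : (A *m z)^T *m r = 0 by rewrite trmx_mul -mulmxA ATr mulmx0.
  by rewrite addr0 add0r mxE.
split=> [mumin | -> nu]; last first.
  by rewrite -/r E lerDl sqr_ge0.
have := mumin (lse A y); rewrite -/r E gerDl => le0.
have /eqP : l2norm (A *m (lse A y - mu)) ^+ 2 = 0.
  by apply/eqP; rewrite eq_le le0 sqr_ge0.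
rewrite l2norm_sqr psumr_eq0 => [/allP A0|i _]; last exact: sqr_ge0.
have Az : A *m (lse A y - mu) = 0.
  apply/matrixP => i j; rewrite (ord1 j) [RHS]mxE.
  by have := A0 i (mem_index_enum _); rewrite /= sqrf_eq0 => /eqP.
have : invmx (A^T *m A) *m (A^T *m (A *m (lse A y - mu))) = 0.
  by rewrite Az !mulmx0.
rewrite [A^T *m (A *m _)]mulmxA mulKmx // => /eqP.
by rewrite subr_eq0 => /eqP.
Qed.

(* E || lse - mu0 ||^2 in the linear model Y = A mu0 + xi; it may be +oo. *)
Definition lse_risk d (T : measurableType d) (R : realType)
    (P : probability T R) (m n : nat) (A : T -> 'M[R]_(m, n))
    (xi : T -> 'cV[R]_m) (mu0 : 'cV[R]_n) : \bar R :=
  ('E_P[fun w => (l2norm (lse (A w) (A w *m mu0 + xi w) - mu0) ^+ 2)%R])%E.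

(* Main.v *)
Require Import Defs.
From HB Require Import structures.
From mathcomp Require Import all_boot all_order all_algebra.
From mathcomp Require Import ring lra.
From mathcomp Require Import all_classical all_reals all_analysis.
From mathcomp Require Import measurable_realfun.
Import Order.TTheory GRing.Theory Num.Theory.
Import numFieldNormedType.Exports.
Local Open Scope classical_set_scope.
Local Open Scope ring_scope.

(* If [G] has an infinite risk, so must [B]; hence [b0] is chosen so that the
   risk for [B] is always infinite.  Let [U] be uniform on [-1, 1], [Z = U^k] with
   [k] odd and larger than [m], and [b0 = M (Z, Z^3, ..., Z^(2n-1))], where [M] is
   the Gram-Schmidt matrix that makes [E b0 b0^T] the identity.
   - If the [Z_i^2] are distinct, a vector in the kernel of [B] gives a polynomial
     of degree at most [n] with [m > n] roots; hence [B^T B] is a.s. invertible.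
   - [Z] charges the neighbourhoods of 0 heavily: [0 < U_i <= s] for all [i] has
     probability [(s/2)^m], and then the entries of [B] are at most [K s^k].  If
     moreover all [xi_i >= 1], then [c = B v = (Z_i)_i / sqrt m] is positive in
     every coordinate, and [c^T xi = c^T B h] for [h] the error of the estimator,
     since the residual is orthogonal to the columns of [B]; this forces [h] to be
     at least of order [s^-k].  So the risk is at least [C s^(m-2k)] for every
     [s]. *)

(** * Linear algebra *)

(** Induction on the dimension by symmetric elimination: clearing the first row and column leaves
    the pivot [a] and its Schur complement [D], again symmetric and positive definite. The pivot is
    normalised by [1 / sqrt a]. *)
Lemma posdef_congruent1 (R : rcfType) (n : nat) (S : 'M[R]_n) :
  S^T = S -> (forall v : 'rV_n, v != 0 -> 0 < (v *m S *m v^T) 0 0) ->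
  exists M : 'M[R]_n, M *m S *m M^T = 1%:M.
Proof.
elim: n S => [|n IH] S symS pdS.
  by exists 0; apply/matrixP => -[].
rewrite -[n.+1]/(1 + n)%N in S symS pdS *.
pose a := S 0 0; pose c : 'cV_n := a^-1 *: dlsubmx S.
have a_gt0 : 0 < a.
  have e0 : (delta_mx 0 0 : 'rV[R]_(1 + n)) != 0.
    by apply/eqP => /matrixP/(_ 0 0)/eqP; rewrite !mxE eqxx oner_eq0.
  by have := pdS _ e0; rewrite -rowE trmx_delta -colE !mxE.
have ulS : ulsubmx S = a%:M.
  by apply/matrixP => i j; rewrite !ord1 !mxE/= mulr1n; congr (S _ _); apply/val_inj.
have urS : ursubmx S = (dlsubmx S)^T by rewrite trmx_dlsub symS.
pose N : 'M[R]_(1 + n) := block_mx 1%:M 0 (- c) 1%:M.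
pose D := drsubmx S - c *m (dlsubmx S)^T.
have NSN : N *m S *m N^T = block_mx a%:M 0 0 D.
  rewrite -[S in LHS]submxK ulS urS /N tr_block_mx !mulmx_block.
  rewrite !(mul1mx, mul0mx, mulmx0, mulmx1, trmx0, trmx1, addr0, add0r).
  rewrite linearN/= mulNmx.
  have ca : c *m a%:M = dlsubmx S.
    by rewrite mul_mx_scalar scalerA mulfV ?scale1r// gt_eqF.
  have ac : a%:M *m c^T = (dlsubmx S)^T.
    by rewrite -ca trmx_mul tr_scalar_mx.
  rewrite ca addNr mul0mx add0r mulmxN ac addNr mulNmx addrC.
  by congr block_mx; rewrite /D addrC.
have [||M' M'D] := IH D.
- have := congr1 trmx NSN; rewrite !trmx_mul trmxK symS mulmxA NSN.
  by rewrite tr_block_mx => /eq_block_mx[_ _ _ /esym].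
- move=> v v0.
  (* The form [D] at [v] is the form [S] at [row_mx 0 v *m N], which is nonzero because its right
     block is [v]. *)
  have w0 : row_mx 0 v *m N != 0.
    rewrite mul_row_block !mul0mx mulmx1 !add0r.
    by apply: contra v0 => /eqP/(congr1 rsubmx); rewrite row_mxKr => ->; rewrite linear0.
  have := pdS _ w0; rewrite trmx_mul !mulmxA.
  rewrite -(mulmxA _ N) -(mulmxA _ (N *m S)) NSN tr_row_mx.
  by rewrite mul_row_block mul_row_col !mul0mx trmx0 !mulmx0 !add0r.
exists (block_mx (Num.sqrt a)^-1%:M 0 0 M' *m N).
rewrite trmx_mul !mulmxA -(mulmxA _ N) -(mulmxA _ (N *m S)) NSN.
rewrite tr_block_mx !mulmx_block !trmx0.
rewrite !(mul0mx, mulmx0, addr0, add0r) M'D tr_scalar_mx -!scalar_mxM.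
rewrite (_ : _ * _ * _ = 1) -?scalar_mx_block//.
by rewrite mulrAC -expr2 exprVn sqr_sqrtr ?mulVf ?gt_eqF// ltW.
Qed.

(** The sum is [z i] times a polynomial [p] in [z i ^+ 2], so the squares are [m] distinct roots of
    a polynomial of degree at most [n]. *)
Lemma odd_powers_free (R : fieldType) (m n : nat) (z : 'I_m -> R)
    (y : 'I_n -> R) :
  (n < m)%N -> injective (fun i => z i ^+ 2) ->
  (forall i, \sum_j y j * z i ^+ j.*2.+1 = 0) -> forall j, y j = 0.
Proof.
move=> nm injz y0.
pose p : {poly R} := \poly_(j < n) (if insub j is Some i then y i else 0).
suff p0 : p = 0.
  by move=> j; have := congr1 (coefp j) p0; rewrite /= coef_poly ltn_ord valK coef0.
(* Multiplying the hypothesis by [z i], instead of dividing by it, also covers [z i = 0]; the price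
   is the extra factor ['X]. *)
have p0 i : ('X * p).[z i ^+ 2] = 0.
  rewrite hornerM hornerX horner_poly expr2 -mulrA mulr_sumr.
  rewrite (eq_bigr (fun j : 'I_n => y j * z i ^+ j.*2.+1)) ?y0 ?mulr0// => j _.
  by rewrite valK -expr2 -exprM mulrCA -exprS mul2n.
have /eqP : 'X * p = 0.
  apply: (@roots_geq_poly_eq0 _ _ [seq z i ^+ 2 | i <- enum 'I_m]).
  - by apply/allP => _ /mapP[i _ ->]; rewrite /root p0.
  - by rewrite map_inj_uniq ?enum_uniq.
  - rewrite size_map size_enum_ord (leq_trans _ nm)//.
    rewrite (leq_trans (size_polyMleq _ _))// size_polyX/=.
    by rewrite ltnS size_poly.
by rewrite mulf_eq0 polyX_eq0 => /eqP.
Qed.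

(** If [A^T A y = 0], then [y^T A^T A y], the sum of the squares of the entries of [A y],
    vanishes. *)
Lemma gram_unit (R : realFieldType) (m n : nat) (A : 'M[R]_(m, n)) :
  (forall y : 'cV_n, A *m y = 0 -> y = 0) -> A^T *m A \in unitmx.
Proof.
move=> injA; rewrite -row_free_unit; apply: inj_row_free => v vAA.
apply: trmx_inj; rewrite trmx0; apply: injA; set x := A *m v^T.
have : \sum_i x i 0 ^+ 2 = 0.
  transitivity ((x^T *m x) 0 0).
    by rewrite [RHS]mxE; apply: eq_bigr => i _; rewrite [x^T _ _]mxE expr2.
  by rewrite /x trmx_mul trmxK -mulmxA (mulmxA A^T) mulmxA vAA mul0mx mxE.
move=> /eqP; rewrite psumr_eq0 => [/allP x0|i _]; last exact: sqr_ge0.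
apply/matrixP => i j; rewrite (ord1 j) [RHS]mxE.
by have := x0 i (mem_index_enum _); rewrite /= sqrf_eq0 => /eqP.
Qed.

(** The error [h] solves [A^T A h = A^T xi]. Pairing with [v] gives [c^T A h = c^T xi] for
    [c = A v]. The right side is at least the sum of [c]; the left side is at most that sum times
    [t n ||h||]. Dividing by the positive sum gives the bound. *)
Lemma lse_error_ge (R : realType) (m n : nat) (A : 'M[R]_(m, n)) (t : R)
    (v mu : 'cV_n) (xi : 'cV_m) :
  (0 < m)%N -> A^T *m A \in unitmx -> (forall i j, `|A i j| <= t) ->
  (forall i, 0 < (A *m v) i 0) -> (forall i, 1 <= xi i 0) ->
  1 <= t * (n%:R * l2norm (lse A (A *m mu + xi) - mu)).
Proof.
move=> m0 uA At Av_gt0 xi1.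
set h := lse _ _ - mu.
have Ah : A^T *m (A *m h) = A^T *m xi.
  have -> : h = invmx (A^T *m A) *m (A^T *m xi).
    by rewrite /h /lse mulmxDr !mulmxA -(mulmxA _ _ A) mulVmx// mul1mx addrAC subrr add0r.
  by rewrite mulmxA mulKVmx.
set c := A *m v.
have hj j : `|h j 0| <= l2norm h.
  rewrite -sqrtr_sqr ler_wsqrtr// (bigD1 j)//= lerDl sumr_ge0// => i _.
  exact: sqr_ge0.
have Ahi i : (A *m h) i 0 <= t * (n%:R * l2norm h).
  rewrite mxE (le_trans (ler_norm _))// (le_trans (ler_norm_sum _ _ _))//.
  rewrite -[n in n%:R]card_ord mulrCA mulr_natl -sumr_const ler_sum// => j _.
  by rewrite normrM ler_pM.
have sc : 0 < \sum_i c i 0.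
  rewrite (bigD1 (Ordinal m0))//= ltr_wpDr ?Av_gt0// sumr_ge0// => i _.
  exact/ltW/Av_gt0.
rewrite -(ler_pM2l sc) mulr1 mulr_suml.
have : \sum_i c i 0 * (A *m h) i 0 = \sum_i c i 0 * xi i 0.
  have E (w : 'cV_m) : \sum_i c i 0 * w i 0 = (v^T *m (A^T *m w)) 0 0.
    rewrite mulmxA -trmx_mul -/c [RHS]mxE.
    by apply: eq_bigr => i _; rewrite [c^T _ _]mxE.
  by rewrite !E Ah.
move=> E; apply: (@le_trans _ _ (\sum_i c i 0 * xi i 0)).
  by apply: ler_sum => i _; rewrite ler_peMr// ltW.
by rewrite -E; apply: ler_sum => i _; rewrite ler_wpM2l// ltW.
Qed.

(** * Moments of the uniform law *)

Lemma finite_roots (R : idomainType) (p : {poly R}) :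
  p != 0 -> finite_set [set x | root p x].
Proof.
have [k] := ubnP (size p); elim: k p => // k IH p pk p0.
have [[a pa]|noroot] := pselect (exists a, root p a); last first.
  by rewrite (_ : [set _ | _] = set0)// -subset0 => x px; apply: noroot; exists x.
have [q pE] := factor_theorem _ _ pa.
have q0 : q != 0 by apply: contraNneq p0 => q0; rewrite pE q0 mul0r.
have -> : [set x | root p x] = [set x | root q x] `|` [set a].
  apply/seteqP; split => x /=; rewrite pE rootM root_XsubC.
    by move=> /orP[|/eqP]; [left|right].
  by move=> [->//|->]; rewrite eqxx orbT.
rewrite finite_setU; split=> //; apply: (IH _ _ q0).
by move: pk; rewrite pE (size_Mmonic q0 (monicXsubC a)) size_XsubC addn2.
Qed.

Section uniform_moments.
Variable R : realType.
Local Notation mu := (@lebesgue_measure R).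

Lemma ltrN11 : -1 < 1 :> R.
Proof. by lra. Qed.

Local Notation Rm := (measurableTypeR R).
Local Notation U := (uniform_prob ltrN11).

Lemma measurable_horner (p : {poly R}) :
  measurable_fun [set: Rm] (horner p : Rm -> R).
Proof. exact: (continuous_measurable_fun (@continuous_horner R p)). Qed.

Lemma measurable_roots (p : {poly R}) : measurable ([set x | root p x] : set Rm).
Proof.
rewrite (_ : [set _ | _] = horner p @^-1` [set 0]).
  by rewrite -[X in measurable X]setTI; exact: measurable_horner.
by apply/seteqP; split=> x /= /rootP.
Qed.

Lemma uniform_roots0 (p : {poly R}) : p != 0 -> U [set x | root p x] = 0%E.
Proof.
move=> p0; have /null_content_dominatesP := dominates_uniform_prob ltrN11.
apply; first exact: measurable_roots.
exact/countable_lebesgue_measure0/finite_set_countable/finite_roots.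
Qed.

Lemma integrable_horner (p : {poly R}) :
  U.-integrable [set: Rm] (EFin \o (horner p : Rm -> R)).
Proof.
have cp := @continuous_horner R p.
have mp : measurable_fun [set: Rm] (EFin \o (horner p : Rm -> R)).
  by apply/measurable_EFinP; exact: measurable_horner.
apply/integrableP; split => //.
rewrite integral_uniform//; last exact: measurableT_comp.
have /integrableP[_ lty] : mu.-integrable `[(-1) : R, 1] (EFin \o horner p).
  apply: continuous_compact_integrable; first exact: segment_compact.
  exact: continuous_subspaceT.
by rewrite lte_mul_pinfty ?lee_fin// invr_ge0; lra.
Qed.

Lemma uniform_integral_opp (f : R -> R) :
  continuous f -> (forall x, 0 <= f x) ->
  (\int[U]_x (f x)%:E = \int[U]_x (f (- x))%:E)%E.
Proof.
move=> cf f0.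
have cNf : continuous (f \o -%R).
  by move=> x; apply: continuous_comp; [exact: opp_continuous|exact: cf].
have E (g : R -> R) : continuous g -> (forall x, 0 <= g x) ->
    (\int[U]_x (g x)%:E = (1 - -1)^-1%:E * \int[mu]_(x in `[(-1)%R, 1%R]) (g x)%:E)%E.
  move=> cg g0; apply: integral_uniform => [|x]; last by rewrite lee_fin.
  by apply/(measurable_EFinP [set: Rm]); exact: (continuous_measurable_fun cg).
rewrite (E _ cf f0) (E _ cNf (fun x => f0 (- x))).
congr (_ * _)%E.
have := @integration_by_substitution_oppr R f (-1) 1 (ltW ltrN11).
by rewrite opprK => -> //; exact: continuous_subspaceT.
Qed.

Lemma uniform_odd_moment0 (p : {poly R}) :
  (forall x, p.[- x] = - p.[x]) -> \int[U]_x p.[x] = 0.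
Proof.
move=> podd.
have ip := integrable_horner p.
have iap : U.-integrable [set: Rm] (EFin \o (fun x : Rm => `|p.[x]|)).
  exact: integrable_norm ip.
(* [integral_uniform] needs a nonnegative integrand, hence the detour by [|p| + p],
   which the reflection turns into [|p| - p]. *)
have cap : continuous (fun x => `|p.[x]| + p.[x]).
  move=> x; apply: cvgD; last exact: continuous_horner.
  by apply: cvg_norm; exact: continuous_horner.
have : \int[U]_x (`|p.[x]| + p.[x]) = \int[U]_x (`|p.[x]| + (-1) * p.[x]).
  rewrite /Rintegral uniform_integral_opp//.
    by congr fine; apply: eq_integral => x _; rewrite podd normrN mulN1r.
  by move=> x; have := ler_norm (- p.[x]); rewrite normrN; lra.
rewrite !RintegralD// ?RintegralZl//; first by lra.
rewrite (_ : _ \o _ = EFin \o (horner (- p))); first exact: integrable_horner.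
by apply/funext => x; rewrite /= hornerN mulN1r.
Qed.

(** This gives positive definiteness of the Gram matrix. If the integral were 0, [p] would vanish
    almost everywhere, although its roots form a null set. *)
Lemma uniform_sqr_moment_gt0 (p : {poly R}) :
  p != 0 -> 0 < \int[U]_x (p ^+ 2).[x].
Proof.
move=> p0.
have p2_ge0 x : 0 <= (p ^+ 2).[x] by rewrite horner_exp sqr_ge0.
rewrite lt_neqAle Rintegral_ge0// andbT eq_sym; apply/eqP => I0.
have : (\int[U]_x `|(p ^+ 2).[x]%:E| = 0)%E.
  under eq_integral do rewrite gee0_abs ?lee_fin//.
  apply/eqP; rewrite -fine_eq0; first exact/eqP.
  exact: (integrable_fin_num measurableT (integrable_horner _)).
have mp2 : measurable_fun [set: Rm] (fun x : Rm => (p ^+ 2).[x]%:E).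
  by apply/(measurable_EFinP [set: Rm]); exact: measurable_horner.
move=> /(ae_eq_integral_abs U measurableT mp2)[A [mA UA0 sA]].
have Ap := measurable_roots p; have UAp := uniform_roots0 _ p0.
(* The exceptional set [A] and the roots of [p] are both null and together cover the line. *)
have : (U setT <= 0)%E.
  rewrite -(_ : A `|` [set x | root p x] = setT); last first.
    apply/seteqP; split => // x _; have [px|px] := boolP (root p x); [by right|left].
    apply: sA => /= /(_ Logic.I)[] /eqP; rewrite horner_exp sqrf_eq0.
    by move: px; rewrite rootE => /negbTE ->.
  have UA : U A = 0%E := UA0.
  have : (U (A `|` [set x | root p x]) <= U A + U [set x | root p x])%E.
    exact: measureU2.
  by rewrite UA UAp adde0.
by rewrite probability_setT lee_fin; lra.
Qed.

Lemma uniform_lower_tail (s : R) : 0 < s <= 1 ->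
  U [set x | 0 < x <= s] = (s / 2)%:E.
Proof.
move=> /andP[s0 s1].
have E : [set x | 0 < x <= s] = `]0, s]%classic by apply/seteqP; split=> x /=; rewrite in_itv.
have mI : measurable (`]0, s]%classic : set Rm) by exact: measurable_itv.
have := integral_indic U measurableT mI; rewrite setIT E => <-.
rewrite integral_uniform; last 2 first.
- by apply/(measurable_EFinP [set: Rm]); exact: measurable_indic.
- by move=> x; rewrite lee_fin.
have -> : (\int[mu]_(x in `[(-1)%R, 1%R]) (\1_(`]0, s] : set R) x)%:E = s%:E)%E.
  rewrite integral_indic// setIidl.
    by apply: (eq_trans (lebesgue_measure_itv _)); rewrite /= lte_fin s0 oppr0 adde0.
  move=> x /=; rewrite !in_itv/= => /andP[x0 xs].
  by rewrite (le_trans xs s1) andbT (le_trans _ (ltW x0))// lerN10.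
by rewrite -EFinM opprK mulrC.
Qed.

End uniform_moments.

(** * Tools from probability: a Gaussian tail, a lower bound on expectations, null sets of
    independent pairs *)

(** On [[1, 2]], an interval of length 1, the density is at least its value at 2. *)
Lemma normal_upper_tail_gt0 (R : realType) :
  exists2 p : R, 0 < p & (p%:E <= normal_prob 0 1 (`[1%R, +oo[%classic : set R))%E.
Proof.
exists (normal_pdf 0 1 2).
  by rewrite normal_pdfE ?oner_eq0// mulr_gt0 ?expR_gt0// normal_peak_gt0 ?oner_eq0.
rewrite /normal_prob.
pose I : set R := `[1, 2]%classic.
have mpdf : measurable_fun [set: measurableTypeR R]
    (fun x : measurableTypeR R => (normal_pdf 0 1 x)%:E).
  apply/(measurable_EFinP [set: measurableTypeR R]).
  exact: measurable_normal_pdf.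
have mI : measurable (I : set (measurableTypeR R)) by exact: measurable_itv.
apply: (@le_trans _ _ (\int[lebesgue_measure]_(x in I) (normal_pdf 0 1 x)%:E)%E); last first.
  apply: ge0_subset_integral => //.
  - exact: measurable_funTS mpdf.
  - by move=> x _; rewrite lee_fin normal_pdf_ge0.
  - by move=> x; rewrite /I/= !in_itv/= => /andP[->].
apply: (@le_trans _ _ (\int[lebesgue_measure]_(x in I) (cst (normal_pdf 0 1 2)%:E x))%E).
  rewrite integral_cst// [X in (_ * X)%E](_ : _ = 1%E) ?mule1//.
  apply: (eq_trans (lebesgue_measure_itv _)).
  by rewrite /= lte_fin ltr1n -EFinB; congr EFin; lra.
apply: ge0_le_integral => //.
- by move=> x _; rewrite lee_fin normal_pdf_ge0.
- exact: measurable_funTS mpdf.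
move=> x; rewrite /I/= in_itv/= lee_fin => /andP[x1 x2].
rewrite !normal_pdfE ?oner_eq0// ler_wpM2l ?normal_peak_ge0// ler_expR.
rewrite ler_pM2r ?invr_gt0 ?expr1n//.
by rewrite !subr0 lerN2; nra.
Qed.

Section expectation_bound.
Import HBNNSimple.

(** The integral of a nonnegative function is a supremum over the simple functions below it, and [c]
    times the indicator of [A] is one of them. As [f] is arbitrary, the squared error of the
    estimator can be bounded without establishing its measurability. *)
Lemma expectation_ge_on (d : measure_display) (T : measurableType d) (R : realType)
    (P : probability T R) (f : T -> R) (A : set T) (c : R) :
  measurable A -> 0 <= c -> (forall w, 0 <= f w) -> (forall w, A w -> c <= f w) ->
  (c%:E * P A <= 'E_P[f])%E.
Proof.
move=> mA c0 f0 fA.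
rewrite unlock ge0_integralTE; last by move=> x; rewrite lee_fin.
pose h := scale_nnsfun (indic_nnsfun R mA) c0.
have -> : (c%:E * P A = sintegral P h)%E by rewrite sintegralrM sintegral_indic.
apply: ereal_sup_ubound; exists h => // w /=; rewrite lee_fin.
rewrite -[X in X <= _]/(c * \1_A w) indicE.
by have [/set_mem /fA|] := boolP (w \in A); rewrite ?mulr1 ?mulr0.
Qed.

End expectation_bound.

(** The product rule on rectangles identifies the joint law with [nu \x nu], and the measure of [D]
    is then the integral of the measures of its sections. *)
Lemma indep_pair_null (d d' : measure_display) (T : measurableType d)
    (T' : measurableType d') (R : realType) (P : probability T R)
    (nu : probability T' R) (X Y : T -> T') (D : set (T' * T')) :
  measurable_fun setT X -> measurable_fun setT Y ->
  (forall U V, measurable U -> measurable V ->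
     P (X @^-1` U `&` Y @^-1` V) = (nu U * nu V)%E) ->
  measurable D -> (forall x, nu (xsection D x) = 0%E) ->
  P [set w | D (X w, Y w)] = 0%E.
Proof.
move=> mX mY XY mD D0.
have mXY : measurable_fun setT (fun w => (X w, Y w)).
  exact: measurable_fun_pair.
have <- : (nu \x nu)%E D = P [set w | D (X w, Y w)].
  apply: (@product_measure_unique _ _ _ _ _ nu nu (pushforward P (fun w => (X w, Y w)))) => //.
by apply: integral0_eq => x _; exact: D0.
Qed.

(** * Orthonormalisation of odd polynomials under the uniform law *)

Section moments.
Variable R : realType.
Local Notation Rm := (measurableTypeR R).
Local Notation U := (uniform_prob (@ltrN11 R)).

Definition moment (p : {poly R}) : R := \int[U]_x p.[x].

Lemma expectation_horner (p : {poly R}) :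
  ('E_U[(fun x : Rm => p.[x]%R)] = (moment p)%:E)%E.
Proof.
rewrite unlock /moment /Rintegral fineK//.
exact: (integrable_fin_num measurableT (integrable_horner _ p)).
Qed.

Lemma moment_sum (I : finType) (c : I -> R) (p : I -> {poly R}) :
  moment (\sum_i c i *: p i) = \sum_i c i * moment (p i).
Proof.
have mD (q r : {poly R}) : moment (q + r) = moment q + moment r.
  rewrite /moment -(RintegralD measurableT (integrable_horner _ q) (integrable_horner _ r)).
  by apply: eq_Rintegral => x _; rewrite hornerD.
have mZ (a : R) q : moment (a *: q) = a * moment q.
  rewrite /moment -(RintegralZl a measurableT (integrable_horner _ q)).
  by apply: eq_Rintegral => x _; rewrite hornerZ.
have m0 : moment 0 = 0 by rewrite -(scale0r 0) mZ mul0r.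
rewrite (big_morph moment mD m0).
by apply: eq_bigr => i _; exact: mZ.
Qed.

Variables (n h : nat).
Let k := h.*2.+1.

(** With [Z = 'X^k], this is the combination of [Z, Z^3, ...] with coefficients [c]. Row [j] of the
    Gram-Schmidt matrix will give coordinate [j] of [b0]. *)
Definition odd_poly_of (c : 'rV[R]_n) : {poly R} :=
  \sum_a c 0 a *: 'X^(k * a.*2.+1).

Lemma odd_poly_of_horner (c : 'rV[R]_n) (x : R) :
  (odd_poly_of c).[x] = \sum_a c 0 a * (x ^+ k) ^+ a.*2.+1.
Proof.
rewrite horner_sum; apply: eq_bigr => a _.
by rewrite hornerZ hornerXn exprM.
Qed.

Lemma odd_poly_of_eq0 (c : 'rV[R]_n) : odd_poly_of c = 0 -> c = 0.
Proof.
move=> c0; apply/rowP => a; rewrite mxE.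
have := congr1 (coefp (k * a.*2.+1)) c0; rewrite /= coef_sum coef0 => <-.
rewrite (bigD1 a)//= coefZ coefXn eqxx mulr1 big1 ?addr0// => b ba.
rewrite coefZ coefXn eqn_pmul2l// eqSS (inj_eq double_inj).
by rewrite eq_sym (inj_eq val_inj) (negbTE ba) mulr0.
Qed.

Lemma moment_odd_poly_of (c : 'rV[R]_n) : moment (odd_poly_of c) = 0.
Proof.
apply: uniform_odd_moment0 => x; rewrite !odd_poly_of_horner -sumrN.
apply: eq_bigr => a _; rewrite -!exprM exprNn -signr_odd oddM /k/= !odd_double/=.
by rewrite expr1 mulN1r mulrN.
Qed.

Definition gram : 'M[R]_n :=
  \matrix_(a, b) moment ('X^(k * a.*2.+1) * 'X^(k * b.*2.+1)).

Lemma moment_odd_poly_ofM (c d : 'rV[R]_n) :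
  moment (odd_poly_of c * odd_poly_of d) = (c *m gram *m d^T) 0 0.
Proof.
rewrite /odd_poly_of mulr_suml.
under eq_bigr do rewrite -scalerAl mulr_sumr.
rewrite moment_sum -mulmxA mxE; apply: eq_bigr => a _; congr (_ * _).
under eq_bigr do rewrite -scalerAr.
rewrite moment_sum mxE; apply: eq_bigr => b _.
by rewrite mulrC !mxE.
Qed.

(** The quadratic form of [gram] at [c] is the second moment of [odd_poly_of c], hence positive
    definite, so some [M] satisfies [M gram M^T = 1]. This identity also makes [M] invertible. *)
Lemma orthonormal_odd_polys : exists M : 'M[R]_n, M \in unitmx /\
  forall i j, moment (odd_poly_of (row i M) * odd_poly_of (row j M)) = (i == j)%:R.
Proof.
have [||M MgM] := @posdef_congruent1 R n gram.
- by apply/matrixP => a b; rewrite !mxE mulrC.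
- move=> v v0; rewrite -moment_odd_poly_ofM -expr2.
  by apply: uniform_sqr_moment_gt0; apply: contra_neq v0; exact: odd_poly_of_eq0.
have [unitM _] : M \in unitmx /\ gram *m M^T \in unitmx.
  by apply: mulmx1_unit; rewrite mulmxA.
exists M; split=> // i j; rewrite moment_odd_poly_ofM.
have := congr1 (fun A : 'M[R]_n => A i j) MgM; rewrite [in RHS]mxE => <-.
rewrite -row_mul [LHS]mxE [RHS]mxE; apply: eq_bigr => l _.
by rewrite ![row _ _ _ _]mxE ![_^T _ _]mxE [row _ _ _ _]mxE.
Qed.

End moments.

(** * The law of [b0] *)

Lemma measurable_set_eq (d : measure_display) (T : measurableType d)
    (R : realType) (f g : T -> R) :
  measurable_fun setT f -> measurable_fun setT g -> measurable [set t | f t = g t].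
Proof.
move=> mf mg; rewrite (_ : [set _ | _] = (f \- g) @^-1` [set 0]).
  by rewrite -[X in measurable X]setTI; exact: (measurable_funB mf mg).
by apply/seteqP; split => t /= /eqP; rewrite ?subr_eq0 => /eqP // ->; rewrite subrr.
Qed.

Section curve.
Variables (R : realType) (n h : nat).
Local Notation Rm := (measurableTypeR R).
Local Notation U := (uniform_prob (@ltrN11 R)).
Let k := h.*2.+1.

(** The value of [b0] at [U = x]: the probability space of [b0] is the real line with the uniform
    law. *)
Definition curve (M : 'M[R]_n) (x : Rm) : n.-tuple R :=
  [tuple (odd_poly_of R n h (row j M)).[x] | j < n].

Lemma measurable_curve (M : 'M[R]_n) : measurable_fun setT (curve M).
Proof.
apply/measurable_fun_tnthP => j.
rewrite (_ : _ \o _ = horner (odd_poly_of R n h (row j M))).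
  exact: measurable_horner.
by apply/funext => x; rewrite /= tnth_mktuple.
Qed.

Definition curve_rv (M : 'M[R]_n) : {RV U >-> n.-tuple R} :=
  mfun_Sub (mem_set (measurable_curve M)).

Lemma centered_curve (M : 'M[R]_n) : centered U (curve_rv M).
Proof.
move=> j; transitivity (moment R (odd_poly_of R n h (row j M)))%:E; last first.
  by rewrite moment_odd_poly_of.
rewrite -expectation_horner.
by congr (expectation U _); apply/funext => x; rewrite /= tnth_mktuple.
Qed.

Lemma second_moment_curve (M : 'M[R]_n) :
  (forall i j,
     moment R (odd_poly_of R n h (row i M) * odd_poly_of R n h (row j M)) = (i == j)%:R) ->
  has_second_moment U (curve_rv M) 1%:M.
Proof.
move=> M1 i j; rewrite mxE -M1 -expectation_horner.
congr (expectation U _); apply/funext => x.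
by rewrite mxE big_ord1 !mxE !tnth_mktuple hornerM.
Qed.

Lemma colv_curve (M : 'M[R]_n) (x : R) :
  colv (curve M x) = M *m \col_a (x ^+ k) ^+ a.*2.+1.
Proof.
apply/colP => j; rewrite !mxE tnth_mktuple odd_poly_of_horner.
by apply: eq_bigr => a _; rewrite !mxE.
Qed.

End curve.

(** * Null sets and the small-entries event for a single row *)

Section design.
Variables (R : realType) (n h : nat).
Local Notation Rm := (measurableTypeR R).
Local Notation U := (uniform_prob (@ltrN11 R)).
Let k := h.*2.+1.
Variable M : 'M[R]_n.+1.
Hypothesis unitM : M \in unitmx.
Local Notation b0 := (curve_rv R n.+1 h M).

(** Recovers [(Z, Z^3, ...)] from a row. Only the law of the rows of [B0] is given, so [Z] has to be
    a measurable function of the row itself; it is coordinate 0, which exists because the dimension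
    is [n.+1]. *)
Definition coords (t : n.+1.-tuple R) : 'cV[R]_n.+1 := invmx M *m colv t.

Lemma coords_curve (x : R) (a : 'I_n.+1) : coords (b0 x) a 0 = (x ^+ k) ^+ a.*2.+1.
Proof. by rewrite /coords colv_curve mulKmx// mxE. Qed.

Lemma measurable_coords (a : 'I_n.+1) :
  measurable_fun setT (fun t : n.+1.-tuple R => coords t a 0).
Proof.
rewrite (_ : (fun _ => _) = (fun t => \sum_j invmx M a j * tnth t j)).
  apply: measurable_sum => j; apply: measurable_funM => //.
  exact: measurable_tnth.
by apply/funext => t; rewrite mxE; apply: eq_bigr => j _; rewrite mxE.
Qed.

Definition on_curve : set (n.+1.-tuple R) :=
  [set t | forall a : 'I_n.+1, coords t a 0 = coords t 0 0 ^+ a.*2.+1].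

Lemma measurable_on_curve : measurable on_curve.
Proof.
rewrite (_ : on_curve = \bigcap_(a in [set: 'I_n.+1])
   [set t | coords t a 0 = coords t 0 0 ^+ a.*2.+1]); last first.
  by apply/seteqP; split => t /= tc a; [move=> _|]; exact: tc.
apply: fin_bigcap_measurable => // a _.
apply: measurable_set_eq.
  exact: measurable_coords.
by apply: measurable_funX; exact: measurable_coords.
Qed.

Lemma on_curve0 : distribution U b0 (~` on_curve) = 0%E.
Proof.
rewrite /distribution /pushforward (_ : _ @^-1` _ = set0) ?measure0//.
rewrite -subset0 => x; apply => a.
by rewrite !coords_curve expr1.
Qed.

(** In terms of [U = x] the event reads [x^(2k) = a], the root set of a monic polynomial. *)
Lemma sqr_coord_null (a : R) :
  distribution U b0 [set t | coords t 0 0 ^+ 2 = a] = 0%E.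
Proof.
rewrite -[RHS](uniform_roots0 R ('X^(k * 2) - a%:P)); last first.
  by apply: monic_neq0; exact: monicXnsubC.
congr (U _); apply/seteqP; split=> x /=; rewrite coords_curve expr1 -exprM.
  by move=> <-; rewrite rootE !hornerE subrr.
by rewrite rootE !hornerE subr_eq0 => /eqP.
Qed.

Definition positive_box (r : R) : set (n.+1.-tuple R) :=
  [set t | 0 < coords t 0 0] `&`
  \bigcap_(j in [set: 'I_n.+1]) [set t | `|tnth t j| <= r].

Lemma measurable_positive_box (r : R) : measurable (positive_box r).
Proof.
apply: measurableI.
  rewrite (_ : [set _ | _] = (fun t => coords t 0 0) @^-1` `]0, +oo[%classic).
    by rewrite -[X in measurable X]setTI; apply: measurable_coords.
  by apply/seteqP; split => t /=; rewrite in_itv/= andbT.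
apply: fin_bigcap_measurable => // j _.
rewrite (_ : [set _ | _] = (fun t => tnth t j) @^-1` `[- r, r]%classic).
  by rewrite -[X in measurable X]setTI; apply: measurable_tnth.
by apply/seteqP; split => t /=; rewrite in_itv/= ler_norml.
Qed.

(** If [0 < x <= s], every odd power of [x ^+ k] is at most [s ^+ k], so each entry is at most
    [s ^+ k] times an absolute row sum of [M]. The interval has mass [s / 2]. *)
Lemma positive_box_tail : exists2 K : R, 0 < K & forall s, 0 < s <= 1 ->
  ((s / 2)%:E <= distribution U b0 (positive_box (K * s ^+ k)))%E.
Proof.
(* The sum dominates every row sum at once, and the 1 keeps [K] positive. *)
pose K := 1 + \sum_j \sum_a `|M j a|.
have sM_ge0 j : 0 <= \sum_a `|M j a| by rewrite sumr_ge0.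
exists K; first by rewrite ltr_pwDl// sumr_ge0.
move=> s s01; rewrite -(uniform_lower_tail R s s01).
apply: le_measure; rewrite ?inE.
- rewrite (_ : [set _ | _] = `]0, s]%classic); first exact: measurable_itv.
  by apply/seteqP; split => x /=; rewrite in_itv.
- rewrite -[X in measurable X]setTI.
  by apply: (measurable_curve R n.+1 h M) => //; exact: measurable_positive_box.
move=> x /= /andP[x0 xs]; case/andP: s01 => s0 s1.
have xk0 : 0 < x ^+ k by rewrite exprn_gt0.
have xk1 : x ^+ k <= 1 by apply: exprn_ile1; [exact: ltW|exact: le_trans xs s1].
split => [|j _] /=; first by rewrite coords_curve expr1.
rewrite tnth_mktuple odd_poly_of_horner (le_trans (ler_norm_sum _ _ _))//.
apply: (@le_trans _ _ ((\sum_a `|M j a|) * x ^+ k)).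
  rewrite mulr_suml ler_sum// => a _; rewrite mxE normrM ler_wpM2l//.
  have x_ge0 := ltW x0; have z0 := ltW xk0; rewrite ger0_norm ?exprn_ge0//.
  by rewrite [_ ^+ a.*2.+1]exprS ler_piMr// exprn_ile1.
apply: ler_pM => //; [exact: ltW| |].
  by apply: ler_wpDl => //; rewrite [leRHS](bigD1 j)//= lerDl sumr_ge0.
by apply: lerXn2r => //; rewrite nnegrE ltW.
Qed.

End design.

(** * The risk of the design *)

Lemma expr_le_prode (R : realDomainType) (m : nat) (c : R) (f : \bar R) :
  0 <= c -> (c%:E <= f)%E -> ((c ^+ m)%:E <= \prod_(i < m) f)%E.
Proof.
move=> c0 cf; elim: m => [|m IH]; first by rewrite big_ord0.
by rewrite big_ord_recl exprS EFinM lee_pmul// lee_fin exprn_ge0.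
Qed.

Section risk.
Variables (R : realType) (n h m : nat).
Local Notation U := (uniform_prob (@ltrN11 R)).
Let k := h.*2.+1.
Variable M : 'M[R]_n.+1.
Hypothesis unitM : M \in unitmx.
Hypothesis hnm : (n.+1 < m)%N.
Local Notation b0 := (curve_rv R n.+1 h M).
Local Notation law := (distribution U b0).
Variables (d : measure_display) (T : measurableType d) (P : probability T R).
Variables (B0 : {RV P >-> m.-tuple (n.+1.-tuple R)}).
Hypothesis iidB : iid P (fun i w => tnth (B0 w) i) law.

Lemma measurable_row (i : 'I_m) : measurable_fun setT (fun w => tnth (B0 w) i).
Proof.
apply: (measurableT_comp (measurable_tnth i)).
exact: measurable_funPT.
Qed.

Lemma ae_rows_on_curve :
  {ae P, forall w, forall i, on_curve R n M (tnth (B0 w) i)}.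
Proof.
apply: filter_forall => i.
exists ((fun w => tnth (B0 w) i) @^-1` (~` on_curve R n M)); split => //.
- rewrite -[X in measurable X]setTI; apply: measurable_row => //.
  by apply: measurableC; exact: measurable_on_curve.
- apply: (eq_trans (iidB.1 i _ _)); last exact: on_curve0.
  by apply: measurableC; exact: measurable_on_curve.
Qed.

(** Mutual independence, with the whole space in every slot other than [i] and [l]. *)
Lemma indep_rows (i l : 'I_m) (V W : set (n.+1.-tuple R)) : i != l ->
  measurable V -> measurable W ->
  P ((fun w => tnth (B0 w) i) @^-1` V `&` (fun w => tnth (B0 w) l) @^-1` W)
  = (law V * law W)%E.
Proof.
move=> il mV mW.
pose S j := if j == i then V else if j == l then W else setT.
have mS j : measurable (S j) by rewrite /S; case: ifP => // _; case: ifP.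
have := iidB.2 S mS.
have -> : \bigcap_j ((fun w => tnth (B0 w) j) @^-1` S j) =
    (fun w => tnth (B0 w) i) @^-1` V `&` (fun w => tnth (B0 w) l) @^-1` W.
  apply/seteqP; split => w /=.
    move=> SB; split.
      by have := SB i Logic.I; rewrite /S/= eqxx.
    by have := SB l Logic.I; rewrite /S/= eqxx eq_sym (negbTE il).
  move=> [BV BW] j _; rewrite /S/=.
  by case: eqP => [->//|_]; case: eqP => [->|].
move=> ->.
rewrite (bigD1 i)//= (bigD1 l) 1?eq_sym//= big1 ?mule1.
  by rewrite !iidB.1// /S eqxx eqxx eq_sym (negbTE il).
move=> j /andP[ji jl]; rewrite iidB.1// /S (negbTE ji) (negbTE jl).
exact: probability_setT.
Qed.

(** There are finitely many pairs of rows. For each pair, once one row is fixed, the other has the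
    same square with probability 0 by [sqr_coord_null]. *)
Lemma ae_sqr_coords_inj :
  {ae P, forall w, injective (fun i => coords R n M (tnth (B0 w) i) 0 0 ^+ 2)}.
Proof.
suff : {ae P, forall w, forall i l, i != l ->
   coords R n M (tnth (B0 w) i) 0 0 ^+ 2 != coords R n M (tnth (B0 w) l) 0 0 ^+ 2}.
  apply: filterS => w H i l; apply: contra_eq => il; exact: H.
apply: filter_forall => i; apply: filter_forall => l.
have [->|il] := eqVneq i l; first by apply: filterE => w; rewrite eqxx.
pose D := [set u : n.+1.-tuple R * n.+1.-tuple R |
  coords R n M u.1 0 0 ^+ 2 = coords R n M u.2 0 0 ^+ 2].
have mD : measurable D.
  apply: measurable_set_eq; apply: measurable_funX.
    by apply: (measurableT_comp (measurable_coords R n M 0)).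
  by apply: (measurableT_comp (measurable_coords R n M 0)).
exists [set w | D (tnth (B0 w) i, tnth (B0 w) l)]; split.
- rewrite (_ : [set _ | _] = (fun w => (tnth (B0 w) i, tnth (B0 w) l)) @^-1` D)//.
  rewrite -[X in measurable X]setTI; apply: measurable_fun_pair => //; exact: measurable_row.
- apply: (indep_pair_null _ _ _ _ _ P law) => //.
  + exact: measurable_row.
  + exact: measurable_row.
  + by move=> V W mV mW; exact: indep_rows.
  + move=> x; rewrite -(sqr_coord_null R n h M unitM (coords R n M x 0 0 ^+ 2)).
    congr (law _); apply/seteqP; split => t; rewrite /xsection/= inE/D/=.
      by move=> ->.
    by move=> ->.
- by move=> w /= /not_implyP[_ /negP]; rewrite negbK => /eqP.
Qed.

(** On the curve, row [i] of [B0 y = 0] says that the odd powers of [Z_i], weighted by the entries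
    of [M^T y], sum to 0. Then [odd_powers_free] gives [M^T y = 0]. *)
Lemma ae_gram_unit (c : R) : c != 0 ->
  {ae P, forall w, (c *: mx (B0 w))^T *m (c *: mx (B0 w)) \in unitmx}.
Proof.
move=> c0.
apply: filterS2 ae_rows_on_curve ae_sqr_coords_inj => w Bcurve Binj.
apply: gram_unit => y; rewrite -scalemxAl => /eqP.
rewrite scaler_eq0 (negbTE c0)/= => /eqP By0.
suff My0 : M^T *m y = 0 by rewrite -[y](mulKmx (_ : M^T \in unitmx)) ?unitmx_tr// My0 mulmx0.
apply/colP => a; rewrite [RHS]mxE.
apply: (odd_powers_free _ _ _ _ (fun a => (M^T *m y) a 0) hnm Binj) => i.
transitivity ((mx (B0 w) *m y) i 0); last by rewrite By0 mxE.
have -> : (mx (B0 w) *m y) i 0 = ((colv (tnth (B0 w) i))^T *m y) 0 0.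
  by rewrite !mxE; apply: eq_bigr => j _; rewrite !mxE.
rewrite -[colv _](mulKVmx unitM) trmx_mul -mulmxA [RHS]mxE.
apply: eq_bigr => j _; rewrite mulrC; congr (_ * _).
by rewrite [RHS]mxE; exact/esym/Bcurve.
Qed.

Variable xi : {RV P >-> m.-tuple R}.
Hypothesis gaussian_xi : standard_gaussian_vector P xi.
Hypothesis indepBxi : independent P B0 xi.
Local Notation B w := ((Num.sqrt m%:R)^-1 *: mx (B0 w)).

(** The event asks that all rows lie in [positive_box] and all noises be at least 1; independence
    turns its probability into a product of one-row and one-noise bounds. *)
Lemma small_event_prob : exists2 p : R, 0 < p & exists2 K : R, 0 < K &
  forall s, 0 < s <= 1 -> exists A : set T, [/\ measurable A,
    (((s * p) ^+ m)%:E <= P A)%E,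
    (forall w i, A w -> 0 < coords R n M (tnth (B0 w) i) 0 0),
    (forall w i j, A w -> `|tnth (tnth (B0 w) i) j| <= K * s ^+ k) &
    (forall w i, A w -> 1 <= tnth (xi w) i)].
Proof.
have [p p0 pN] := normal_upper_tail_gt0 R.
have [K K0 KE] := positive_box_tail R n h M unitM.
(* Absorbs the 1/2 of the row bound: [s * (p / 2) = (s / 2) * p]. *)
exists (p / 2); first by rewrite divr_gt0.
exists K => // s s01.
pose V := positive_box R n M (K * s ^+ k).
have mV : measurable V by exact: measurable_positive_box.
pose W : set R := `[1, +oo[%classic.
have mW : measurable W by exact: measurable_itv.
pose V' := [set t : m.-tuple (n.+1.-tuple R) | forall i, V (tnth t i)].
pose W' := [set t : m.-tuple R | forall i, W (tnth t i)].
have mbig e (S : measurableType e) (Z : set S) : measurable Z ->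
    measurable [set t : m.-tuple S | forall i, Z (tnth t i)].
  move=> mZ; rewrite (_ : [set _ | _] =
      \bigcap_(i in [set: 'I_m]) (fun t => tnth t i) @^-1` Z).
    apply: fin_bigcap_measurable => // i _.
    by rewrite -[X in measurable X]setTI; exact: measurable_tnth.
  by apply/seteqP; split => t /= tZ i; [move=> _|]; exact: tZ.
exists (B0 @^-1` V' `&` xi @^-1` W'); split.
- by apply: measurableI; rewrite -[X in measurable X]setTI;
    apply: measurable_funPT => //; exact: mbig.
- rewrite indepBxi; [|exact: mbig|exact: mbig].
  have -> : P (B0 @^-1` V') = (\prod_(i < m) law V)%E.
    rewrite -(eq_bigr _ (fun i _ => iidB.1 i V mV)) -(iidB.2 (fun=> V)) //.
    by congr (P _); apply/seteqP; split => w /= wV i; [move=> _|]; exact: wV.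
  have -> : P (xi @^-1` W') = (\prod_(i < m) normal_prob 0 1 W)%E.
    rewrite -(eq_bigr _ (fun i _ => gaussian_xi.1 i W mW)).
    rewrite -(gaussian_xi.2 (fun=> W)) //.
    by congr (P _); apply/seteqP; split => w /= wV i; [move=> _|]; exact: wV.
  have s0 : 0 <= s by case/andP: s01 => /ltW.
  have s2 : 0 <= s / 2 by rewrite divr_ge0.
  rewrite (_ : s * _ = (s / 2) * p); last by rewrite mulrCA mulrC.
  rewrite [_ ^+ m]exprMn EFinM.
  apply: lee_pmul; rewrite ?lee_fin ?exprn_ge0 ?(ltW p0)//.
    by apply: expr_le_prode => //; exact: KE.
  by apply: expr_le_prode => //; exact: ltW.
- by move=> w i [/= /(_ i)[]].
- by move=> w i j [/= /(_ i)[_ /(_ j Logic.I)]].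
- by move=> w i [/= _ /(_ i)]; rewrite /W/= in_itv/= andbT.
Qed.

Hypothesis hmk : (m <= k)%N.

Lemma lse_risk_infinite (mu0 : 'cV[R]_n.+1) :
  lse_risk P (fun w => B w) (fun w => colv (xi w)) mu0 = +oo%E.
Proof.
have m0 : (0 < m)%N by apply: leq_trans hnm.
have sqrtm_ge1 : 1 <= Num.sqrt m%:R :> R.
  by rewrite -[leLHS]sqrtr1 ler_wsqrtr// ler1n.
have sqrtm_gt0 : 0 < Num.sqrt m%:R :> R by apply: lt_le_trans sqrtm_ge1.
have [p p0 [K K0 smallE]] := small_event_prob.
have [N [mN PN0 unitN]] : P.-negligible (~` [set w | (B w)^T *m B w \in unitmx]).
  by apply: ae_gram_unit; rewrite invr_neq0// gt_eqF.
pose C := p ^+ m / (K * n.+1%:R) ^+ 2.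
have C0 : 0 < C by rewrite divr_gt0 ?exprn_gt0 ?mulr_gt0 ?ltr0n.
suff risk_ge s : 0 < s <= 1 ->
    ((C / s)%:E <= lse_risk P (fun w => B w) (fun w => colv (xi w)) mu0)%E.
  apply/eqyP => r r0.
  (* Chosen so that [C / s = C + r], which exceeds the arbitrary level [r], while [s <= 1]. *)
  pose s := C / (C + r).
  have s01 : 0 < s <= 1.
    by rewrite /s divr_gt0 ?addr_gt0//= ler_pdivrMr ?addr_gt0// mul1r lerDl ltW.
  apply: le_trans (risk_ge s s01); rewrite lee_fin /s.
  have -> : C / (C / (C + r)) = C + r by field; rewrite !gt_eqF ?addr_gt0.
  by rewrite lerDr ltW.
move=> s01; have /andP[s0 s1] := s01.
have [A [mA PA Az Ab Axi]] := smallE s s01.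
pose t := K * s ^+ k.
have t0 : 0 < t by rewrite mulr_gt0 ?exprn_gt0.
have tn0 : 0 < t * n.+1%:R by rewrite mulr_gt0 ?ltr0n.
(* Removing the null set [N] costs no probability; outside it the Gram matrix is invertible, so
   [lse] does not fall back on the default value of [invmx]. *)
have PAN : (((s * p) ^+ m)%:E <= P (A `\` N))%E.
  apply: (le_trans PA); apply: (@le_trans _ _ (P ((A `\` N) `|` N))).
    apply: le_measure; rewrite ?inE//; first by apply: measurableU => //; exact: measurableD.
    by move=> w Aw; have [Nw|Nw] := pselect (N w); [right|left].
  have : (P ((A `\` N) `|` N) <= P (A `\` N) + P N)%E.
    by apply: measureU2 => //; exact: measurableD.
  by rewrite PN0 adde0.
have err w : (A `\` N) w -> (t * n.+1%:R) ^- 2 <=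
    l2norm (lse (B w) (B w *m mu0 + colv (xi w)) - mu0) ^+ 2.
  move=> [Aw Nw].
  have uB : (B w)^T *m B w \in unitmx by apply: contrapT => /unitN.
  (* With this [v], entry [i] of [B v] is [Z_i / sqrt m], positive on [A]. *)
  pose v : 'cV_n.+1 := (row 0 (invmx M))^T.
  have := lse_error_ge R m n.+1 (B w) t v mu0 (colv (xi w)) m0 uB.
  set e := l2norm _ => eb.
  have {}eb : 1 <= t * (n.+1%:R * e).
    apply: eb => [i j|i|i].
    - rewrite !mxE normrM ger0_norm ?invr_ge0 ?sqrtr_ge0//.
      rewrite -[leRHS]mul1r ler_pM ?invr_ge0 ?sqrtr_ge0 ?Ab//.
      by rewrite invf_le1.
    - rewrite -scalemxAl mxE mulr_gt0 ?invr_gt0//.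
      rewrite (_ : _ i 0 = coords R n M (tnth (B0 w) i) 0 0) ?Az//.
      by rewrite !mxE; apply: eq_bigr => j _; rewrite !mxE mulrC.
    - by rewrite mxE Axi.
  rewrite -exprVn ler_pXn2r// ?nnegrE ?invr_ge0 ?sqrtr_ge0 ?(ltW tn0)//.
  by rewrite -[leLHS]mulr1 ler_pdivrMl// -mulrA.
apply: le_trans (expectation_ge_on _ _ _ P _ _ _ _ _ _ err).
- apply: le_trans (lee_wpmul2l _ PAN); last by rewrite lee_fin invr_ge0 sqr_ge0.
  rewrite -EFinM lee_fin.
  have -> : (t * n.+1%:R) ^- 2 * (s * p) ^+ m = C * (s ^+ m / (s ^+ k) ^+ 2).
    by rewrite /C /t mulrAC !exprMn; field; rewrite !gt_eqF ?exprn_gt0.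
  (* What remains is [s^(2k) <= s^(m+1)]. It holds because [s <= 1] and [m + 1 <= k + 1 <= 2k]. *)
  rewrite ler_pM2l// ler_pdivlMr ?exprn_gt0// -exprM ler_pdivrMl//.
  rewrite -exprS ler_wiXn2l// ?ltW//.
  by rewrite muln2 -addnn (leq_trans (_ : _ <= k.+1)%N)// -addn1 leq_add2l.
- exact: measurableD.
- by rewrite invr_ge0 sqr_ge0.
- by move=> w; exact: sqr_ge0.
Qed.

End risk.

(** * Comparison with the Gaussian design *)

Theorem proposition3p13 (R : realType) (m n : nat) (L : R)
    (hm : (2 <= m)%N) (hmn : (n < m)%N) (hL : 1 < L) :
  exists (d0 : measure_display) (T0 : measurableType d0)
         (P0 : probability T0 R) (b0 : {RV P0 >-> n.-tuple R}),
    [/\ centered P0 b0,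
        has_second_moment P0 b0 1%:M &
        forall (dB : measure_display) (TB : measurableType dB)
               (PB : probability TB R)
               (B0 : {RV PB >-> m.-tuple (n.-tuple R)})
               (xiB : {RV PB >-> m.-tuple R}),
          let B := fun w => (Num.sqrt m%:R)^-1 *: mx (B0 w) in
          iid PB (fun i w => tnth (B0 w) i) (distribution P0 b0) ->
          standard_gaussian_vector PB xiB ->
          independent PB B0 xiB ->
          (* the least squares estimator for B is a.s. uniquely defined *)
          {ae PB, forall w, (B w)^T *m B w \in unitmx} /\
          forall (dG : measure_display) (TG : measurableType dG)
                 (PG : probability TG R)
                 (G : {RV PG >-> m.-tuple (n.-tuple R)})
                 (xiG : {RV PG >-> m.-tuple R}),
            gaussian_design PG G ->
            standard_gaussian_vector PG xiG ->
            independent PG G xiG ->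
            forall mu0 : 'cV[R]_n,
              ((n%:R^-1)%:E * lse_risk PB B (fun w => colv (xiB w)) mu0 >=
               L%:E * ((n%:R^-1)%:E *
                 lse_risk PG (fun w => mx (G w)) (fun w => colv (xiG w)) mu0))%E].
Proof.
(* Taking [h := m] makes [k = 2m + 1], odd and larger than [m]. *)
have [M [unitM M1]] := orthonormal_odd_polys R n m.
exists _, _, _, (curve_rv R n m M); split.
- exact: centered_curve.
- exact: second_moment_curve.
move=> dB TB PB B0 xiB B iidB gxi indB.
case: n M unitM M1 hmn B0 @B iidB indB => [|n'] M unitM M1 hmn' B0 B iidB indB.
  (* In dimension 0 the Gram matrix is empty with determinant 1, and both sides of the inequality
     vanish since [0^-1 = 0]. *)
  split; first by apply: filterE => w; rewrite unitmxE det_mx00 unitr1.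
  by move=> dG TG PG G xiG _ _ _ mu0; rewrite invr0 !mul0e mule0.
split; first by apply: ae_gram_unit iidB _ _;
  rewrite // invr_neq0// sqrtr_eq0 -ltNge ltr0n (leq_trans _ hm).
move=> dG TG PG G xiG _ _ _ mu0.
have mk : (m <= m.*2.+1)%N by rewrite -addnn -addnS leq_addr.
(* The normalised risk of [B] is [+oo], which dominates the Gaussian side whatever its value. *)
rewrite (lse_risk_infinite _ _ _ _ _ unitM hmn' _ _ _ _ iidB _ gxi indB mk).
by rewrite gt0_muley ?leey// lte_fin invr_gt0 ltr0n.
Qed.
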